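(* Let $f$ be a nonzero integrable function and let $\alpha: I\subset\mathbb{R}\to\mathbb{E}^3$ be an $f$-rectifying curve, parametrized by its arclength $s$, with strictly positive curvature function. Then, with $F$ the primitive function of $f$ and $\alpha_f(s)=\int f(s)T(s)\,ds$ the $f$-position vector of $\alpha$: 1. The norm function $\rho(s)=|\alpha_f(s)|$ satisfies $\rho(s)=\sqrt{F^2(s)+c^2}$, where $c$ is a nonzero constant. 2. The tangential component of the $f$-position vector $\alpha_f$ is $\langle \alpha_f,T\rangle = F(s)$. 3. The normal component $\alpha_f^{N}$ of the $f$-position vector $\alpha_f$ has constant length. 4. The torsion $\tau$ is nonzero, and the binormal component $\langle\alpha_f,B\rangle$ of the $f$-position vector is constant. Conversely, if $\alpha: I\subset\mathbb{R}\to\mathbb{E}^3$ is a curve with positive curvature $\kappa$ and if one of the assertions 1, 2, 3 or 4 holds, then $\alpha$ is an $f$-rectifying curve.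
   Context: $\mathbb{E}^3$ is Euclidean 3-space with standard inner product $\langle\cdot,\cdot\rangle$ and norm $|\cdot|$. For a curve $\alpha$ parametrized by arclength $s$, $T=\alpha'$ is the unit tangent, $\kappa=|T'|$ the curvature, and (where $\kappa\neq0$) $N$ the principal normal with $T'=\kappa N$, $B=T\times N$ the binormal, and $\tau$ the torsion, so that $T'=\kappa N$, $N'=-\kappa T+\tau B$, $B'=-\tau N$. The rectifying plane at $s$ is the plane spanned by $T(s)$ and $B(s)$. For an integrable function $f$ of the parameter $s$, the $f$-position vector of $\alpha$ is $\alpha_f(s)=\int f(s)T(s)\,ds$, i.e. an antiderivative of $f T$. The curve $\alpha$ is called $f$-rectifying if its $f$-position vector always lies in the rectifying plane of $\alpha$, i.e. $\alpha_f(s)=\lambda(s)T(s)+\mu(s)B(s)$ for some real functions $\lambda,\mu$. ''The primitive function $F$ of $f$'' is an antiderivative of $f$, $F'=f$ (antiderivatives being determined up to an additive constant). The normal component $\alpha_f^{N}$ is the component of $\alpha_f$ orthogonal to $T$: $\alpha_f=\langle\alpha_f,T\rangle T+\alpha_f^{N}$.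
   Formalization: The converse from 3 also assumes that ρ is not constant (it fails for a unit circle with f = 1); ''f nonzero'' means nowhere zero in the converses from 1, 3 and 4, and ''τ nonzero'' means not identically zero. *)

(* Defs.v *)
From Stdlib Require Export Reals.
From Coquelicot Require Export Coquelicot.
Open Scope R_scope.

Definition open_interval (a b : Rbar) (s : R) : Prop :=
  Rbar_lt a s /\ Rbar_lt s b.

(* The product [NormedModule] structure of Coquelicot supplies addition,
   scaling and the notion of derivative; lengths are taken with [enorm]. *)
Definition E3 : Type := (R * R * R)%type.

Definition cx (v : E3) : R := fst (fst v).
Definition cy (v : E3) : R := snd (fst v).
Definition cz (v : E3) : R := snd v.

Definition dot (u v : E3) : R := cx u * cx v + cy u * cy v + cz u * cz v.

Definition enorm (v : E3) : R := sqrt (dot v v).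

Definition cross (u v : E3) : E3 :=
  (cy u * cz v - cz u * cy v,
   cz u * cx v - cx u * cz v,
   cx u * cy v - cy u * cx v).

Definition vDerive (g : R -> E3) (s : R) : E3 :=
  (Derive (fun t => cx (g t)) s,
   Derive (fun t => cy (g t)) s,
   Derive (fun t => cz (g t)) s).

(* All orders up to 4 are listed because [Derive_n] is total: differentiability
   of [Derive_n g 3] alone would say nothing about the lower orders. *)
Definition C4_on (I : R -> Prop) (g : R -> R) : Prop :=
  forall (k : nat) (s : R), (k <= 4)%nat -> I s ->
    ex_derive_n g k s /\ continuous (Derive_n g k) s.

Definition tangent (alpha : R -> E3) : R -> E3 := vDerive alpha.

Definition curvature (alpha : R -> E3) (s : R) : R :=
  enorm (vDerive (tangent alpha) s).

(* Meaningful only where the curvature does not vanish. *)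
Definition normal (alpha : R -> E3) (s : R) : E3 :=
  scal (/ curvature alpha s) (vDerive (tangent alpha) s).

Definition binormal (alpha : R -> E3) (s : R) : E3 :=
  cross (tangent alpha s) (normal alpha s).

(* The B-component of N' = - kappa T + tau B. *)
Definition torsion (alpha : R -> E3) (s : R) : R :=
  dot (vDerive (normal alpha) s) (binormal alpha s).

(* Class C^4 makes the torsion continuously differentiable. *)
Definition unit_speed_curve (I : R -> Prop) (alpha : R -> E3) : Prop :=
  C4_on I (fun s => cx (alpha s)) /\
  C4_on I (fun s => cy (alpha s)) /\
  C4_on I (fun s => cz (alpha s)) /\
  (forall s, I s -> enorm (tangent alpha s) = 1).

Definition antiderivative {V : NormedModule R_AbsRing}
    (I : R -> Prop) (g G : R -> V) : Prop :=
  forall s, I s -> is_derive G s (g s).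

(* Integrability in the sense of indefinite integrals: a primitive exists,
   with F' = f at every point of I. *)
Definition has_primitive (I : R -> Prop) (f : R -> R) : Prop :=
  exists F : R -> R, antiderivative I f F.

(* The f-position vector is determined up to an additive constant vector;
   [alpha_f] is any one choice. *)
Definition is_f_position (I : R -> Prop) (f : R -> R)
    (alpha alpha_f : R -> E3) : Prop :=
  antiderivative I (fun s => scal (f s) (tangent alpha s) : E3) alpha_f.

(* To be used together with [is_f_position I f alpha alpha_f]. *)
Definition f_rectifying (I : R -> Prop) (alpha alpha_f : R -> E3) : Prop :=
  exists lambda mu : R -> R, forall s, I s ->
    alpha_f s = plus (scal (lambda s) (tangent alpha s))
                     (scal (mu s) (binormal alpha s)).

Definition normal_component (alpha alpha_f : R -> E3) (s : R) : E3 :=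
  minus (alpha_f s) (scal (dot (alpha_f s) (tangent alpha s)) (tangent alpha s)).

Definition constant_on (I : R -> Prop) (g : R -> R) : Prop :=
  exists k : R, forall s, I s -> g s = k.

Definition nonzero_on (I : R -> Prop) (g : R -> R) : Prop :=
  exists s, I s /\ g s <> 0.

Definition nowhere_zero_on (I : R -> Prop) (g : R -> R) : Prop :=
  forall s, I s -> g s <> 0.

Definition norm_formula (I : R -> Prop) (F : R -> R) (alpha_f : R -> E3) : Prop :=
  exists c : R, c <> 0 /\
    forall s, I s -> enorm (alpha_f s) = sqrt (F s ^ 2 + c ^ 2).

Definition tangential_formula (I : R -> Prop) (F : R -> R)
    (alpha alpha_f : R -> E3) : Prop :=
  forall s, I s -> dot (alpha_f s) (tangent alpha s) = F s.

Definition normal_length_constant (I : R -> Prop) (alpha alpha_f : R -> E3) : Prop :=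
  constant_on I (fun s => enorm (normal_component alpha alpha_f s)).

(* "tau is nonzero" means that it is not the zero function: the torsion of an
   f-rectifying curve is a constant multiple of kappa F, and so it vanishes
   wherever F does. *)
Definition binormal_constant (I : R -> Prop) (alpha alpha_f : R -> E3) : Prop :=
  nonzero_on I (torsion alpha) /\
  constant_on I (fun s => dot (alpha_f s) (binormal alpha s)).

(* Main.v *)
From Stdlib Require Import Lra Lia ClassicalEpsilon.
Require Import Defs.

(** Write [p], [q], [r] for the components of the f-position vector along the
    tangent, the principal normal and the binormal. Since the position vector
    has derivative [f T], the Frenet equations turn into

      [p' = f + kappa q],   [q' = - kappa p + tau r],   [r' = - tau q],

    and being f-rectifying means that [q] vanishes identically
    ([f_rectifying_iff]).

    If [q = 0], then [p' = f] and [r' = 0]: the primitive of the theorem is [p]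
    itself, [r] is a constant [c], and the squared length of the position vector
    is [p^2 + c^2]. The second equation leaves [kappa p = tau r]; if [c] or [tau]
    were zero, [p] would vanish identically, and so would [f = p']. This is
    [f_rectifying_properties].

    Conversely, [p = F] gives [kappa q = 0] by the first equation. The norm
    formula reduces to this case: the squared norm has derivative [2 f p], the
    squared formula has derivative [2 f F], and [f] is nowhere zero.

    The two other assertions only give a product: constant normal length gives
    [p q = 0], and a constant binormal component gives [tau q = 0]. A product of
    two functions can vanish without either factor being zero, so [q] could a
    priori be zero on a part of the interval and nonzero on another. This is
    excluded at the points where such a change would take place. At a limit [s]
    of points near which [q] vanishes identically, [q] and all its available
    derivatives vanish, and the Frenet equations then show that the other factor
    is nonzero, or has nonzero derivative, at [s]; hence it has no zero close to
    [s], except perhaps [s], and [q] vanishes near [s]. The points near which [q]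
    is zero thus form an open and closed subset of the interval
    ([product_zero_propagation]). For [tau q = 0] this uses the second derivative
    of [q], and therefore the differentiability of [tau]
    ([torsion_derivable]). *)

(** * Vector algebra *)

Lemma E3_eq (u v : E3) : cx u = cx v -> cy u = cy v -> cz u = cz v -> u = v.
Proof. destruct u as [[? ?] ?], v as [[? ?] ?]; cbn; congruence. Qed.

(* Reduces identities between vectors, or their inner products, to identities
   between polynomials in the coordinates. *)
Ltac unfold_coords :=
  unfold dot, cross, cx, cy, cz, plus, minus, opp, scal; cbn;
  unfold plus, opp, mult, scal; cbn; unfold mult; cbn.

Ltac coords := unfold_coords; ring.

Lemma dot_comm u v : dot u v = dot v u.
Proof. coords. Qed.

Lemma dot_plus_l u v w : dot (plus u v) w = dot u w + dot v w.
Proof. coords. Qed.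

Lemma dot_plus_r u v w : dot u (plus v w) = dot u v + dot u w.
Proof. coords. Qed.

Lemma dot_scal_l k u v : dot (scal k u) v = k * dot u v.
Proof. coords. Qed.

Lemma dot_scal_r k u v : dot u (scal k v) = k * dot u v.
Proof. coords. Qed.

Lemma dot_self_nonneg v : 0 <= dot v v.
Proof. unfold dot; nra. Qed.

Lemma dot_cross_l u v : dot u (cross u v) = 0.
Proof. coords. Qed.

Lemma dot_cross_r u v : dot v (cross u v) = 0.
Proof. coords. Qed.

Lemma dot_cross_cross u v :
  dot (cross u v) (cross u v) = dot u u * dot v v - dot u v ^ 2.
Proof. coords. Qed.

Lemma cross_scal_self k u : cross (scal k u) u = zero.
Proof. apply E3_eq; unfold zero; cbn; coords. Qed.

(** The cross product computation behind the binormal equation: for [t = T],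
    [n = N], [x = - kappa] and [y = tau] it evaluates [T x N']. *)
Lemma cross_comb_cross x y t n :
  dot t t = 1 -> dot t n = 0 ->
  cross t (plus (scal x t) (scal y (cross t n))) = scal (- y) n.
Proof.
  intros htt htn.
  transitivity (plus (scal (y * dot t n) t) (scal (- y * dot t t) n)).
  { apply E3_eq; coords. }
  rewrite htt, htn; apply E3_eq; coords.
Qed.

Lemma enorm_sqr v : enorm v ^ 2 = dot v v.
Proof. unfold enorm; rewrite <- Rsqr_pow2, Rsqr_sqrt; auto using dot_self_nonneg. Qed.

Lemma orthonormal_decomposition t n v :
  dot t t = 1 -> dot n n = 1 -> dot t n = 0 ->
  v = plus (plus (scal (dot v t) t) (scal (dot v n) n))
           (scal (dot v (cross t n)) (cross t n)).
Proof.
  intros htt hnn htn.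
  assert (hbb : dot (cross t n) (cross t n) = 1)
    by (rewrite dot_cross_cross, htt, hnn, htn; ring).
  (* Holds for all t and n: the Gram matrix of t and n is inverted up to its
     determinant, which is the squared length of their cross product. *)
  assert (gram : scal (dot (cross t n) (cross t n)) v =
    plus (plus (scal (dot v t * dot n n - dot v n * dot t n) t)
               (scal (dot v n * dot t t - dot v t * dot t n) n))
         (scal (dot v (cross t n)) (cross t n)))
    by (apply E3_eq; coords).
  rewrite hbb, htt, hnn, htn in gram.
  replace v with (scal 1 v) at 1 by (apply E3_eq; coords).
  rewrite gram; apply E3_eq; coords.
Qed.

Lemma orthonormal_parseval t n v :
  dot t t = 1 -> dot n n = 1 -> dot t n = 0 ->
  dot v v = dot v t ^ 2 + dot v n ^ 2 + dot v (cross t n) ^ 2.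
Proof.
  intros htt hnn htn.
  rewrite (orthonormal_decomposition t n v htt hnn htn) at 2.
  rewrite !dot_plus_r, !dot_scal_r; ring.
Qed.

(** * Differentiation of vector functions *)

(** Differentiability coordinate by coordinate, so that the product rules below
    follow from those for real functions. *)
Definition is_vderive (g : R -> E3) (s : R) (v : E3) : Prop :=
  is_derive (fun t => cx (g t)) s (cx v) /\
  is_derive (fun t => cy (g t)) s (cy v) /\
  is_derive (fun t => cz (g t)) s (cz v).

Lemma is_vderive_unique g s v : is_vderive g s v -> vDerive g s = v.
Proof.
  intros (hx & hy & hz); apply E3_eq; unfold vDerive; cbn;
    now apply is_derive_unique.
Qed.

Lemma is_vderive_vDerive g s :
  ex_derive (fun t => cx (g t)) s -> ex_derive (fun t => cy (g t)) s ->
  ex_derive (fun t => cz (g t)) s -> is_vderive g s (vDerive g s).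
Proof. intros; split; [|split]; now apply Derive_correct. Qed.

Lemma is_derive_linear {U V : NormedModule R_AbsRing} (l : U -> V)
    (g : R -> U) s v :
  is_linear l -> is_derive g s v -> is_derive (fun t => l (g t)) s (l v).
Proof.
  intros hl hg.
  apply filterdiff_ext_lin with (fun y => l (scal y v)).
  - apply (filterdiff_comp' g l s (fun y => scal y v) l hg).
    now apply filterdiff_linear.
  - intros y; now apply linear_scal.
Qed.

Lemma is_vderive_of_is_derive (g : R -> E3) s v :
  is_derive g s v -> is_vderive g s v.
Proof.
  intros h.
  pose proof (is_derive_linear _ g s v is_linear_fst h) as h1.
  split; [|split].
  - exact (is_derive_linear _ _ s _ is_linear_fst h1).
  - exact (is_derive_linear _ _ s _ is_linear_snd h1).
  - exact (is_derive_linear _ g s v is_linear_snd h).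
Qed.

Lemma is_derive_Rmult (g h : R -> R) s g' h' :
  is_derive g s g' -> is_derive h s h' ->
  is_derive (fun t => g t * h t) s (g' * h s + g s * h').
Proof. intros hg hh; apply (is_derive_mult g h s g' h' hg hh Rmult_comm). Qed.

Lemma is_derive_eq (g : R -> R) (s l l' : R) : is_derive g s l -> l = l' -> is_derive g s l'.
Proof. now intros ? <-. Qed.

Lemma is_vderive_dot g h s g' h' :
  is_vderive g s g' -> is_vderive h s h' ->
  is_derive (fun t => dot (g t) (h t)) s (dot g' (h s) + dot (g s) h').
Proof.
  intros (gx & gy & gz) (kx & ky & kz).
  eapply is_derive_eq.
  - refine (is_derive_plus _ _ _ _ _ _ _); [refine (is_derive_plus _ _ _ _ _ _ _) |]; apply is_derive_Rmult; eassumption.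
  - unfold dot, plus; cbn; ring.
Qed.

Lemma is_vderive_cross g h s g' h' :
  is_vderive g s g' -> is_vderive h s h' ->
  is_vderive (fun t => cross (g t) (h t)) s
    (plus (cross g' (h s)) (cross (g s) h')).
Proof.
  intros (gx & gy & gz) (kx & ky & kz).
  split; [|split]; (eapply is_derive_eq;
    [refine (is_derive_minus _ _ _ _ _ _ _); apply is_derive_Rmult; eassumption | coords]).
Qed.

Lemma is_vderive_scal (k : R -> R) g s k' g' :
  is_derive k s k' -> is_vderive g s g' ->
  is_vderive (fun t => scal (k t) (g t)) s
    (plus (scal k' (g s)) (scal (k s) g')).
Proof.
  intros hk (gx & gy & gz).
  split; [|split]; (eapply is_derive_eq;
    [apply is_derive_Rmult; eassumption | coords]).
Qed.

(** * Real functions on an open set *)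

Lemma open_open_interval a b : open (open_interval a b).
Proof. apply open_and; [apply open_Rbar_gt | apply open_Rbar_lt]. Qed.

(** Relations that hold along the whole curve are differentiated by means of
    this lemma: the derivative computed by the product rules must be zero. *)
Lemma derive_of_locally_constant (g : R -> R) (k s l : R) :
  locally s (fun t => g t = k) -> is_derive g s l -> l = 0.
Proof.
  intros hg hl.
  rewrite <- (is_derive_unique g s l hl).
  apply is_derive_unique, (is_derive_ext_loc (fun _ => k)).
  - revert hg; apply filter_imp; auto.
  - exact (is_derive_const k s).
Qed.

Lemma open_interval_between a b s t x :
  open_interval a b s -> open_interval a b t -> s <= x <= t ->
  open_interval a b x.
Proof.
  intros [? _] [_ ?] [? ?]; split.
  - now apply Rbar_lt_le_trans with s.
  - now apply Rbar_le_lt_trans with t.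
Qed.

Lemma constant_of_derive_zero a b (g : R -> R) :
  (forall s, open_interval a b s -> is_derive g s 0) ->
  forall s t, open_interval a b s -> open_interval a b t -> g s = g t.
Proof.
  intros hg.
  assert (lt : forall s t, open_interval a b s -> open_interval a b t ->
    s < t -> g s = g t).
  { intros s t hs ht hst; apply eq_is_derive; [|exact hst].
    intros x hx; apply hg; apply (open_interval_between a b s t); auto. }
  intros s t hs ht.
  destruct (Rtotal_order s t) as [h | [-> | h]]; auto.
  symmetry; auto.
Qed.

(** Connectedness of the interval. The hypothesis says that every limit point of
    [P] is interior to [P], so the indicator function of [P] is locally constant;
    its derivative is zero, and it is constant by the mean value theorem. *)
Lemma locally_connected_propagation a b (P : R -> Prop) :
  (forall s, open_interval a b s ->
     ~ locally s (fun t => ~ P t) -> locally s P) ->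
  (exists s, open_interval a b s /\ P s) ->
  forall s, open_interval a b s -> P s.
Proof.
  intros hP [s0 [hs0 Ps0]] s hs.
  set (h t := if excluded_middle_informative (P t) then 1 else 0).
  assert (hh : h s = h s0).
  { apply (constant_of_derive_zero a b); auto.
    intros x hx.
    destruct (classic (locally x (fun t => ~ P t))) as [hx' | hx'].
    - apply (is_derive_ext_loc (fun _ => 0)); [|exact (is_derive_const 0 x)].
      revert hx'; apply filter_imp; intros t ht; unfold h.
      destruct (excluded_middle_informative (P t)); tauto.
    - apply (is_derive_ext_loc (fun _ => 1)); [|exact (is_derive_const 1 x)].
      generalize (hP x hx hx'); apply filter_imp; intros t ht; unfold h.
      destruct (excluded_middle_informative (P t)); tauto. }
  unfold h in hh.
  destruct (excluded_middle_informative (P s)),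
    (excluded_middle_informative (P s0)); tauto || lra.
Qed.

(** A function has no other zero close to a point where it takes a nonzero value,
    or where its derivative is nonzero: in the second case a zero at [t] would
    make the difference quotient between [s] and [t] equal to 0. *)
Lemma locally'_nonzero (g : R -> R) s l :
  is_derive g s l -> g s <> 0 \/ l <> 0 -> locally' s (fun t => g t <> 0).
Proof.
  intros hg hnz.
  destruct (Req_dec (g s) 0) as [gs | gs].
  - destruct hnz as [? | hl]; [tauto|].
    apply is_derive_Reals in hg.
    destruct (hg (Rabs l) (Rabs_pos_lt l hl)) as [d hd].
    exists d; intros t ht hts gt.
    specialize (hd (t - s)).
    rewrite (Rplus_minus s t), gs, gt in hd.
    unfold Rdiv in hd; rewrite Rminus_diag, Rmult_0_l, Rminus_0_l, Rabs_Ropp in hd.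
    apply (Rlt_irrefl (Rabs l)), hd; [now apply Rminus_eq_contra | exact ht].
  - assert (hc : continuous g s)
      by (apply (ex_derive_continuous g s); now exists l).
    assert (locally s (fun t => g t <> 0)) as h.
    { apply (hc (fun y => y <> 0)). now apply open_neq. }
    exact (filter_imp _ _ (fun t gt _ => gt) h).
Qed.

Definition zero_near (g : R -> R) (s : R) : Prop := locally s (fun t => g t = 0).

(** A point of [Q] has a whole neighborhood of zeros of [g], hence zeros other
    than [s]. So [s] is a limit of zeros different from itself. *)
Lemma zero_near_limit (g : R -> R) (Q : R -> Prop) s :
  (forall t, Q t -> zero_near g t) -> ~ locally s (fun t => ~ Q t) ->
  ~ locally' s (fun t => g t <> 0).
Proof.
  intros hQ hlim hnz; apply hlim.
  generalize (locally_locally s _ hnz); apply filter_imp.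
  intros t ht Qt.
  destruct (filter_and _ _ ht (hQ t Qt)) as [d hd].
  assert (only : forall u, ball t d u -> u = s).
  { intros u hu; destruct (hd u hu) as [h1 h2].
    destruct (Req_dec u s); tauto. }
  assert (t = s) by (apply only, ball_center).
  assert (t + d / 2 = s).
  { apply only. unfold ball; cbn; unfold AbsRing_ball, abs, minus, plus, opp; cbn.
    destruct d as [d hd0]; cbn.
    rewrite Rabs_pos_eq; lra. }
  destruct d as [d hd0]; cbn in *; lra.
Qed.

(** Applied to [g] and then to its derivative, with the same limit point, this
    gives a zero of order three. *)
Lemma double_zero_at_limit (g : R -> R) (Q : R -> Prop) s l :
  (forall t, Q t -> zero_near g t) -> ~ locally s (fun t => ~ Q t) ->
  is_derive g s l -> g s = 0 /\ l = 0.
Proof.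
  intros hQ hlim hg.
  assert (h : ~ (g s <> 0 \/ l <> 0)).
  { intros hnz; apply (zero_near_limit g Q s hQ hlim).
    now apply locally'_nonzero with l. }
  split; apply NNPP; tauto.
Qed.

Lemma zero_near_derive (I : R -> Prop) (g g' : R -> R) t :
  open I -> (forall u, I u -> is_derive g u (g' u)) ->
  I t -> zero_near g t -> zero_near g' t.
Proof.
  intros hI hg ht gt; unfold zero_near.
  generalize (filter_and _ _ (hI t ht) (locally_locally t _ gt)).
  apply filter_imp; intros u [hu gu].
  apply (derive_of_locally_constant g 0 u); auto.
Qed.

(** The set of points near which [q] vanishes is open; the third hypothesis makes
    it closed, since next to a limit point of this set the factor [g] is nonzero
    and [q] must vanish. It is nonempty because [q] vanishes where [g] does
    not. *)
Lemma product_zero_propagation a b (g q : R -> R) :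
  (forall s, open_interval a b s -> g s * q s = 0) ->
  (forall s, open_interval a b s -> ex_derive q s) ->
  (forall s, open_interval a b s -> ~ locally s (fun t => ~ zero_near q t) ->
     locally' s (fun t => g t <> 0)) ->
  (exists s, open_interval a b s /\ continuous g s /\ g s <> 0) ->
  forall s, open_interval a b s -> q s = 0.
Proof.
  intros hgq hq hlim [s0 [hs0 [gc gs0]]] s hs.
  apply (locally_singleton s (fun t => q t = 0)).
  apply (locally_connected_propagation a b (zero_near q)); [| | exact hs].
  - clear s hs; intros s hs hacc.
    apply locally_locally.
    destruct (hq s hs) as [l hl].
    destruct (double_zero_at_limit q (zero_near q) s l) as [qs _]; auto.
    generalize (filter_and _ _ (open_open_interval a b s hs) (hlim s hs hacc)).
    apply filter_imp; intros t [ht gt].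
    destruct (Req_dec t s) as [-> | hts]; [exact qs|].
    destruct (Rmult_integral _ _ (hgq t ht)) as [h | h]; [|exact h].
    now destruct (gt hts).
  - exists s0; split; [exact hs0 | unfold zero_near].
    assert (h : locally s0 (fun t => g t <> 0))
      by (apply (gc (fun y => y <> 0)); now apply open_neq).
    generalize (filter_and _ _ (open_open_interval a b s0 hs0) h).
    apply filter_imp; intros t [ht gt].
    destruct (Rmult_integral _ _ (hgq t ht)); tauto.
Qed.

(** * Frenet frame *)

Definition regular_curve (I : R -> Prop) (alpha : R -> E3) : Prop :=
  unit_speed_curve I alpha /\ forall s, I s -> 0 < curvature alpha s.

(** The four derivatives of the curve, read as three derivatives of [T]: the
    third one is needed for the derivative of the torsion. *)
Lemma higher_derivatives I alpha s :
  unit_speed_curve I alpha -> I s ->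
  is_vderive (tangent alpha) s (vDerive (tangent alpha) s) /\
  is_vderive (vDerive (tangent alpha)) s
    (vDerive (vDerive (tangent alpha)) s) /\
  is_vderive (vDerive (vDerive (tangent alpha))) s
    (vDerive (vDerive (vDerive (tangent alpha))) s).
Proof.
  intros (hx & hy & hz & _) hs.
  assert (ex : forall k, (k <= 4)%nat ->
    ex_derive_n (fun t => cx (alpha t)) k s /\
    ex_derive_n (fun t => cy (alpha t)) k s /\
    ex_derive_n (fun t => cz (alpha t)) k s).
  { intros k hk; split; [|split]; [apply hx | apply hy | apply hz]; auto. }
  split; [|split]; apply is_vderive_vDerive;
    [apply (ex 2%nat) | apply (ex 2%nat) | apply (ex 2%nat)
    |apply (ex 3%nat) | apply (ex 3%nat) | apply (ex 3%nat)
    |apply (ex 4%nat) | apply (ex 4%nat) | apply (ex 4%nat)]; lia.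
Qed.

Lemma curvature_derivable I alpha s :
  regular_curve I alpha -> I s -> ex_derive (curvature alpha) s.
Proof.
  intros [hu hk] hs.
  destruct (higher_derivatives I alpha s hu hs) as (_ & h2 & _).
  pose proof (is_vderive_dot _ _ _ _ _ h2 h2) as hd.
  eexists; apply (is_derive_sqrt _ _ _ hd).
  rewrite <- enorm_sqr; apply pow_lt; exact (hk s hs).
Qed.

Lemma tangent_unit I alpha s :
  regular_curve I alpha -> I s -> dot (tangent alpha s) (tangent alpha s) = 1.
Proof.
  intros [(_ & _ & _ & h) _] hs; rewrite <- enorm_sqr, (h s hs); ring.
Qed.

Lemma tangent_vderive I alpha s :
  regular_curve I alpha -> I s ->
  is_vderive (tangent alpha) s (scal (curvature alpha s) (normal alpha s)).
Proof.
  intros [hu hk] hs.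
  destruct (higher_derivatives I alpha s hu hs) as (h1 & _).
  assert (e : scal (curvature alpha s) (normal alpha s) = vDerive (tangent alpha) s).
  { unfold normal.
    rewrite scal_assoc.
    replace (mult _ _) with 1 by (symmetry; apply Rinv_r, Rgt_not_eq, hk, hs).
    exact (scal_one _). }
  now rewrite e.
Qed.

Lemma normal_unit I alpha s :
  regular_curve I alpha -> I s -> dot (normal alpha s) (normal alpha s) = 1.
Proof.
  intros [hu hk] hs; specialize (hk s hs).
  unfold normal; rewrite dot_scal_l, dot_scal_r, <- enorm_sqr.
  fold (curvature alpha s); field; lra.
Qed.

(** Differentiate [<T, T> = 1]. *)
Lemma tangent_normal_orthogonal I alpha s :
  open I -> regular_curve I alpha -> I s ->
  dot (tangent alpha s) (normal alpha s) = 0.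
Proof.
  intros hI hreg hs.
  pose proof (tangent_vderive I alpha s hreg hs) as hT.
  pose proof (is_vderive_dot _ _ _ _ _ hT hT) as hd.
  apply (derive_of_locally_constant _ 1) in hd.
  - rewrite dot_scal_l, dot_scal_r, (dot_comm (normal alpha s)) in hd.
    pose proof (proj2 hreg s hs); nra.
  - generalize (hI s hs); apply filter_imp.
    intros t ht; exact (tangent_unit I alpha t hreg ht).
Qed.

Lemma normal_derivative_exists I alpha s :
  regular_curve I alpha -> I s ->
  exists k, is_vderive (normal alpha) s
    (plus (scal k (vDerive (tangent alpha) s))
       (scal (/ curvature alpha s) (vDerive (vDerive (tangent alpha)) s))).
Proof.
  intros hreg hs.
  destruct (higher_derivatives I alpha s (proj1 hreg) hs) as (_ & h2 & _).
  destruct (curvature_derivable I alpha s hreg hs) as [k hk].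
  pose proof (is_derive_inv _ _ _ hk (Rgt_not_eq _ _ (proj2 hreg s hs))) as hinv.
  eexists; exact (is_vderive_scal _ _ _ _ _ hinv h2).
Qed.

(** The components of [N'] in the frame come from differentiating [<N, N> = 1]
    and [<T, N> = 0]; the third one is the definition of [tau]. *)
Lemma normal_vderive I alpha s :
  open I -> regular_curve I alpha -> I s ->
  is_vderive (normal alpha) s
    (plus (scal (- curvature alpha s) (tangent alpha s))
          (scal (torsion alpha s) (binormal alpha s))).
Proof.
  intros hI hreg hs.
  destruct (normal_derivative_exists I alpha s hreg hs) as [k hN].
  set (N' := plus _ _) in hN.
  assert (htors : torsion alpha s = dot N' (binormal alpha s))
    by (unfold torsion; now rewrite (is_vderive_unique _ _ _ hN)).
  pose proof (tangent_vderive I alpha s hreg hs) as hT.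
  assert (hNN : dot N' (normal alpha s) = 0).
  { pose proof (is_vderive_dot _ _ _ _ _ hN hN) as hd.
    apply (derive_of_locally_constant _ 1) in hd.
    - rewrite (dot_comm (normal alpha s)) in hd; lra.
    - generalize (hI s hs); apply filter_imp.
      intros t ht; exact (normal_unit I alpha t hreg ht). }
  assert (hNT : dot N' (tangent alpha s) = - curvature alpha s).
  { pose proof (is_vderive_dot _ _ _ _ _ hT hN) as hd.
    apply (derive_of_locally_constant _ 0) in hd.
    - rewrite dot_scal_l, (normal_unit I) in hd by assumption.
      rewrite dot_comm; lra.
    - generalize (hI s hs); apply filter_imp.
      intros t ht; exact (tangent_normal_orthogonal I alpha t hI hreg ht). }
  rewrite htors, <- hNT.
  replace (plus _ _) with N'; [exact hN|].
  rewrite (orthonormal_decomposition (tangent alpha s) (normal alpha s) N') at 1;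
    eauto using tangent_unit, normal_unit, tangent_normal_orthogonal.
  rewrite hNN; unfold binormal; apply E3_eq; coords.
Qed.

Lemma binormal_vderive I alpha s :
  open I -> regular_curve I alpha -> I s ->
  is_vderive (binormal alpha) s (scal (- torsion alpha s) (normal alpha s)).
Proof.
  intros hI hreg hs.
  pose proof (is_vderive_cross _ _ _ _ _ (tangent_vderive I alpha s hreg hs)
    (normal_vderive I alpha s hI hreg hs)) as h.
  rewrite cross_scal_self in h; unfold binormal in h.
  rewrite cross_comb_cross, plus_zero_l in h;
    eauto using tangent_unit, tangent_normal_orthogonal.
Qed.

(** [N'] is a combination of [T'] and [T''], and [T'] is orthogonal to [B]. In
    this form the torsion involves no derivative of [N] and is visibly
    differentiable. *)
Lemma torsion_formula I alpha s :
  regular_curve I alpha -> I s ->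
  torsion alpha s =
    dot (vDerive (vDerive (tangent alpha)) s) (binormal alpha s)
      / curvature alpha s.
Proof.
  intros hreg hs.
  destruct (normal_derivative_exists I alpha s hreg hs) as [k hN].
  unfold torsion; rewrite (is_vderive_unique _ _ _ hN).
  rewrite dot_plus_l, !dot_scal_l.
  rewrite (is_vderive_unique _ _ _ (tangent_vderive I alpha s hreg hs)).
  unfold binormal; rewrite dot_scal_l, dot_cross_r.
  unfold Rdiv; ring.
Qed.

Lemma torsion_derivable I alpha s :
  open I -> regular_curve I alpha -> I s -> ex_derive (torsion alpha) s.
Proof.
  intros hI hreg hs.
  destruct (higher_derivatives I alpha s (proj1 hreg) hs) as (_ & _ & h3).
  destruct (curvature_derivable I alpha s hreg hs) as [k hk].
  pose proof (is_vderive_dot _ _ _ _ _ h3 (binormal_vderive I alpha s hI hreg hs))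
    as hdot.
  pose proof (is_derive_div _ _ _ _ _ hdot hk (Rgt_not_eq _ _ (proj2 hreg s hs)))
    as hquot.
  eapply ex_derive_ext_loc; [|eexists; exact hquot].
  generalize (hI s hs); apply filter_imp; intros t ht; symmetry.
  exact (torsion_formula I alpha t hreg ht).
Qed.

(** * The f-position vector in the moving frame *)

Lemma tangential_derive I f alpha alpha_f s :
  regular_curve I alpha -> is_f_position I f alpha alpha_f -> I s ->
  is_derive (fun t => dot (alpha_f t) (tangent alpha t)) s
    (f s + curvature alpha s * dot (alpha_f s) (normal alpha s)).
Proof.
  intros hreg hpos hs.
  pose proof (is_vderive_dot _ _ _ _ _ (is_vderive_of_is_derive _ _ _ (hpos s hs))
    (tangent_vderive I alpha s hreg hs)) as h.
  rewrite dot_scal_l, dot_scal_r, (tangent_unit I), Rmult_1_r in h; assumption.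
Qed.

Lemma principal_derive I f alpha alpha_f s :
  open I -> regular_curve I alpha -> is_f_position I f alpha alpha_f -> I s ->
  is_derive (fun t => dot (alpha_f t) (normal alpha t)) s
    (- curvature alpha s * dot (alpha_f s) (tangent alpha s)
     + torsion alpha s * dot (alpha_f s) (binormal alpha s)).
Proof.
  intros hI hreg hpos hs.
  pose proof (is_vderive_dot _ _ _ _ _ (is_vderive_of_is_derive _ _ _ (hpos s hs))
    (normal_vderive I alpha s hI hreg hs)) as h.
  rewrite dot_scal_l, dot_plus_r, !dot_scal_r, (tangent_normal_orthogonal I),
    Rmult_0_r, Rplus_0_l in h; assumption.
Qed.

Lemma binormal_component_derive I f alpha alpha_f s :
  open I -> regular_curve I alpha -> is_f_position I f alpha alpha_f -> I s ->
  is_derive (fun t => dot (alpha_f t) (binormal alpha t)) s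
    (- torsion alpha s * dot (alpha_f s) (normal alpha s)).
Proof.
  intros hI hreg hpos hs.
  pose proof (is_vderive_dot _ _ _ _ _ (is_vderive_of_is_derive _ _ _ (hpos s hs))
    (binormal_vderive I alpha s hI hreg hs)) as h.
  unfold binormal at 2 in h.
  rewrite dot_scal_l, dot_scal_r, dot_cross_l, Rmult_0_r, Rplus_0_l in h; assumption.
Qed.

Lemma square_norm_derive I f alpha alpha_f s :
  is_f_position I f alpha alpha_f -> I s ->
  is_derive (fun t => dot (alpha_f t) (alpha_f t)) s
    (2 * f s * dot (alpha_f s) (tangent alpha s)).
Proof.
  intros hpos hs.
  pose proof (is_vderive_of_is_derive _ _ _ (hpos s hs)) as hv.
  eapply is_derive_eq; [apply (is_vderive_dot _ _ _ _ _ hv hv)|].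
  rewrite dot_scal_l, dot_scal_r, (dot_comm (tangent alpha s)); ring.
Qed.

Lemma position_parseval I alpha alpha_f s :
  open I -> regular_curve I alpha -> I s ->
  dot (alpha_f s) (alpha_f s) =
    dot (alpha_f s) (tangent alpha s) ^ 2 + dot (alpha_f s) (normal alpha s) ^ 2
    + dot (alpha_f s) (binormal alpha s) ^ 2.
Proof.
  intros hI hreg hs; apply orthonormal_parseval;
    eauto using tangent_unit, normal_unit, tangent_normal_orthogonal.
Qed.

Lemma normal_component_sqr I alpha alpha_f s :
  regular_curve I alpha -> I s ->
  enorm (normal_component alpha alpha_f s) ^ 2 =
    dot (alpha_f s) (alpha_f s) - dot (alpha_f s) (tangent alpha s) ^ 2.
Proof.
  intros hreg hs; rewrite enorm_sqr; unfold normal_component.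
  set (p := dot (alpha_f s) (tangent alpha s)).
  transitivity (dot (alpha_f s) (alpha_f s) - 2 * p * dot (alpha_f s) (tangent alpha s)
    + p ^ 2 * dot (tangent alpha s) (tangent alpha s)).
  - unfold p; coords.
  - rewrite (tangent_unit I alpha s hreg hs); fold p; ring.
Qed.

Lemma f_rectifying_iff I alpha alpha_f :
  open I -> regular_curve I alpha ->
  f_rectifying I alpha alpha_f <->
  (forall s, I s -> dot (alpha_f s) (normal alpha s) = 0).
Proof.
  intros hI hreg; split.
  - intros (lambda & mu & h) s hs; rewrite (h s hs), dot_plus_l, !dot_scal_l.
    rewrite (tangent_normal_orthogonal I) by assumption.
    rewrite (dot_comm (binormal alpha s)); unfold binormal.
    rewrite dot_cross_r; ring.
  - intros hq.
    exists (fun s => dot (alpha_f s) (tangent alpha s)),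
      (fun s => dot (alpha_f s) (binormal alpha s)).
    intros s hs.
    rewrite (orthonormal_decomposition (tangent alpha s) (normal alpha s) (alpha_f s)) at 1;
      eauto using tangent_unit, normal_unit, tangent_normal_orthogonal.
    rewrite (hq s hs); unfold binormal; apply E3_eq; coords.
Qed.

(** * Characterizations of f-rectifying curves *)

Lemma f_rectifying_properties a b f alpha alpha_f :
  let I := open_interval a b in
  nonzero_on I f -> regular_curve I alpha -> is_f_position I f alpha alpha_f ->
  f_rectifying I alpha alpha_f ->
  exists F : R -> R, antiderivative I f F /\
    norm_formula I F alpha_f /\
    tangential_formula I F alpha alpha_f /\
    normal_length_constant I alpha alpha_f /\
    binormal_constant I alpha alpha_f.
Proof.
  intros I [s0 [hs0 fs0]] hreg hpos hrect.
  assert (hI : open I) by apply open_open_interval.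
  pose proof (proj1 (f_rectifying_iff I alpha alpha_f hI hreg) hrect) as hq.
  set (p t := dot (alpha_f t) (tangent alpha t)).
  set (r t := dot (alpha_f t) (binormal alpha t)).
  assert (hp : antiderivative I f p).
  { intros s hs; eapply is_derive_eq; [now apply (tangential_derive I f)|].
    rewrite (hq s hs); ring. }
  assert (hr : forall s, I s -> r s = r s0).
  { intros s hs; apply (constant_of_derive_zero a b); try assumption.
    intros t ht; eapply is_derive_eq; [now apply (binormal_component_derive I f)|].
    rewrite (hq t ht); ring. }
  (* q = 0 in the equation for q' *)
  assert (balance : forall s, I s -> curvature alpha s * p s = torsion alpha s * r s).
  { intros s hs.
    pose proof (principal_derive I f alpha alpha_f s hI hreg hpos hs) as h.
    apply (derive_of_locally_constant _ 0) in h.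
    - fold (p s) (r s) in h; lra.
    - generalize (hI s hs); apply filter_imp; exact hq. }
  assert (hpnz : ~ forall s, I s -> p s = 0).
  { intros h0; apply fs0.
    apply (derive_of_locally_constant p 0 s0); [|now apply hp].
    generalize (hI s0 hs0); apply filter_imp; exact h0. }
  assert (vanish : forall s, I s -> torsion alpha s * r s0 = 0 -> p s = 0).
  { intros s hs h; rewrite <- (hr s hs), <- (balance s hs) in h.
    pose proof (proj2 hreg s hs); nra. }
  assert (hsq : forall s, I s -> dot (alpha_f s) (alpha_f s) = p s ^ 2 + r s0 ^ 2).
  { intros s hs; rewrite (position_parseval I alpha) by assumption.
    rewrite (hq s hs); fold (p s) (r s); rewrite (hr s hs); ring. }
  exists p; split; [exact hp | split; [|split; [|split; [|split]]]].
  - exists (r s0); split.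
    + intros h; apply hpnz; intros s hs; apply vanish; [exact hs|].
      rewrite h; ring.
    + intros s hs; unfold enorm; now rewrite (hsq s hs).
  - intros s hs; reflexivity.
  - exists (Rabs (r s0)); intros s hs.
    rewrite <- (Rabs_pos_eq (enorm _)) by apply sqrt_pos.
    apply Rsqr_eq_abs_0; rewrite !Rsqr_pow2.
    rewrite (normal_component_sqr I) by assumption.
    rewrite (hsq s hs); fold (p s); ring.
  - apply NNPP; intros h; apply hpnz; intros s hs; apply vanish; [exact hs|].
    replace (torsion alpha s) with 0; [ring|].
    symmetry; apply NNPP; intros ht; apply h; now exists s.
  - exists (r s0); exact hr.
Qed.

Lemma f_rectifying_of_tangential I f F alpha alpha_f :
  open I -> regular_curve I alpha -> is_f_position I f alpha alpha_f ->
  antiderivative I f F -> tangential_formula I F alpha alpha_f ->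
  f_rectifying I alpha alpha_f.
Proof.
  intros hI hreg hpos hF htan.
  apply f_rectifying_iff; auto.
  intros s hs.
  assert (h : is_derive F s
    (f s + curvature alpha s * dot (alpha_f s) (normal alpha s))).
  { apply (is_derive_ext_loc (fun t => dot (alpha_f t) (tangent alpha t))).
    - generalize (hI s hs); apply filter_imp; exact htan.
    - now apply (tangential_derive I f). }
  apply is_derive_unique in h.
  rewrite (is_derive_unique _ _ _ (hF s hs)) in h.
  pose proof (proj2 hreg s hs); nra.
Qed.

(** Both sides of the squared norm formula are differentiated:
    [2 f p = 2 f F]. *)
Lemma tangential_of_norm I f F alpha alpha_f :
  open I -> is_f_position I f alpha alpha_f -> antiderivative I f F ->
  nowhere_zero_on I f -> norm_formula I F alpha_f ->
  tangential_formula I F alpha alpha_f.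
Proof.
  intros hI hpos hF hf (c & _ & hc) s hs.
  assert (hsq : forall t, I t -> dot (alpha_f t) (alpha_f t) - c ^ 2 = F t * F t).
  { intros t ht; rewrite <- enorm_sqr, (hc t ht), pow2_sqrt by nra; ring. }
  assert (h : is_derive (fun t => F t * F t) s
    (2 * f s * dot (alpha_f s) (tangent alpha s) - 0)).
  { apply (is_derive_ext_loc (fun t => dot (alpha_f t) (alpha_f t) - c ^ 2)).
    - generalize (hI s hs); apply filter_imp; exact hsq.
    - refine (is_derive_minus _ _ _ _ _ _ _).
      + now apply (square_norm_derive I).
      + exact (is_derive_const (c ^ 2) s). }
  apply is_derive_unique in h.
  rewrite (is_derive_unique _ _ _ (is_derive_Rmult _ _ _ _ _ (hF s hs) (hF s hs))) in h.
  apply (Rmult_eq_reg_l (2 * f s)); [lra|].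
  specialize (hf s hs); lra.
Qed.

(** The squared length of the normal component is [|alpha_f|^2 - p^2], whose
    derivative is [- 2 kappa p q]; hence [p q = 0]. At a point where [q = 0], the
    derivative [p' = f + kappa q] is nonzero. If [p] vanished identically, the
    position vector would be its own normal component and have constant
    length. *)
Lemma f_rectifying_of_normal_length a b f alpha alpha_f :
  let I := open_interval a b in
  regular_curve I alpha -> is_f_position I f alpha alpha_f ->
  nowhere_zero_on I f -> normal_length_constant I alpha alpha_f ->
  ~ constant_on I (fun s => enorm (alpha_f s)) ->
  f_rectifying I alpha alpha_f.
Proof.
  intros I hreg hpos hf [k hk] hnorm.
  assert (hI : open I) by apply open_open_interval.
  apply f_rectifying_iff; auto.
  set (p t := dot (alpha_f t) (tangent alpha t)).
  set (q t := dot (alpha_f t) (normal alpha t)).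
  assert (hp : forall s, I s -> is_derive p s (f s + curvature alpha s * q s))
    by (intros; now apply (tangential_derive I f)).
  assert (hq : forall s, I s -> ex_derive q s)
    by (intros; eexists; now apply (principal_derive I f)).
  assert (hpq : forall t, I t -> dot (alpha_f t) (alpha_f t) - p t * p t = k ^ 2).
  { intros t ht; rewrite <- (hk t ht), (normal_component_sqr I) by assumption.
    unfold p; ring. }
  apply (product_zero_propagation a b p q); [|exact hq| |].
  - intros s hs.
    pose proof (is_derive_minus _ _ _ _ _ (square_norm_derive I f _ _ _ hpos hs)
      (is_derive_Rmult _ _ _ _ _ (hp s hs) (hp s hs))) as h.
    apply (derive_of_locally_constant _ (k ^ 2)) in h.
    + unfold minus, plus, opp in h; cbn in h; fold (p s) in h.
      apply (Rmult_eq_reg_l (curvature alpha s)); [nra|].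
      apply Rgt_not_eq, (proj2 hreg), hs.
    + generalize (hI s hs); apply filter_imp; exact hpq.
  - intros s hs hlim.
    destruct (hq s hs) as [l hl].
    destruct (double_zero_at_limit q (zero_near q) s l) as [qs _]; auto.
    apply (locally'_nonzero p s _ (hp s hs)).
    right; rewrite qs, Rmult_0_r, Rplus_0_r; now apply hf.
  - apply NNPP; intros hnone; apply hnorm.
    assert (p0 : forall s, I s -> p s = 0).
    { intros s hs; apply NNPP; intros ps; apply hnone; exists s.
      split; [exact hs | split; [|exact ps]].
      apply (ex_derive_continuous p s); eexists; now apply hp. }
    exists k; intros s hs.
    rewrite <- (hk s hs); unfold normal_component.
    fold (p s); rewrite (p0 s hs).
    f_equal; apply E3_eq; coords.
Qed.

(** As [r] is constant, [tau q = - r'] is zero. At a limit of points near which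
    [q] vanishes, [q = q' = q'' = 0]. If moreover [tau = 0] there, then
    [q' = - kappa p + tau r] gives [p = 0], so that [q'' = 0] reads
    [tau' r = kappa f], and [tau'] is nonzero because [f] is. *)
Lemma f_rectifying_of_binormal a b f alpha alpha_f :
  let I := open_interval a b in
  regular_curve I alpha -> is_f_position I f alpha alpha_f ->
  nowhere_zero_on I f -> binormal_constant I alpha alpha_f ->
  f_rectifying I alpha alpha_f.
Proof.
  intros I hreg hpos hf [[s0 [hs0 hts0]] [k hk]].
  assert (hI : open I) by apply open_open_interval.
  apply f_rectifying_iff; auto.
  set (p t := dot (alpha_f t) (tangent alpha t)).
  set (q t := dot (alpha_f t) (normal alpha t)).
  set (q' t := - (curvature alpha t * p t) + k * torsion alpha t).
  assert (hp : forall s, I s -> is_derive p s (f s + curvature alpha s * q s))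
    by (intros; now apply (tangential_derive I f)).
  assert (hq : forall s, I s -> is_derive q s (q' s)).
  { intros s hs; eapply is_derive_eq; [now apply (principal_derive I f)|].
    unfold q'; rewrite (hk s hs); fold (p s); ring. }
  assert (ht : forall s, I s -> ex_derive (torsion alpha) s)
    by (intros; now apply (torsion_derivable I)).
  apply (product_zero_propagation a b (torsion alpha) q).
  - intros s hs.
    pose proof (binormal_component_derive I f alpha alpha_f s hI hreg hpos hs) as h.
    apply (derive_of_locally_constant _ k) in h.
    + fold (q s) in h; lra.
    + generalize (hI s hs); apply filter_imp; exact hk.
  - intros s hs; eexists; now apply hq.
  - intros s hs hlim.
    destruct (ht s hs) as [t' ht'].
    destruct (curvature_derivable I alpha s hreg hs) as [k' hk'].
    apply (locally'_nonzero _ _ _ ht').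
    destruct (double_zero_at_limit q (zero_near q) s (q' s)) as [qs q's]; auto.
    (* q' differentiated with r replaced by its constant value k *)
    assert (hq'' : is_derive q' s
      (- (k' * p s + curvature alpha s * (f s + curvature alpha s * q s)) + k * t')).
    { refine (is_derive_plus _ _ _ _ _ _ (is_derive_scal _ _ _ _ ht')).
      exact (is_derive_opp _ _ _ (is_derive_Rmult _ _ _ _ _ hk' (hp s hs))). }
    destruct (double_zero_at_limit q' (fun t => I t /\ zero_near q t) s
      (- (k' * p s + curvature alpha s * (f s + curvature alpha s * q s))
       + k * t')) as [_ q''s].
    { intros t [hIt hqt]; exact (zero_near_derive I q q' t hI hq hIt hqt). }
    { intros hno; apply hlim.
      generalize (filter_and _ _ (hI s hs) hno); apply filter_imp; tauto. }
    { exact hq''. }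
    destruct (Req_dec (torsion alpha s) 0) as [ts | ts]; [right | now left].
    intros t'0.
    pose proof (proj2 hreg s hs) as kpos.
    assert (ps : p s = 0) by (unfold q' in q's; rewrite ts in q's; nra).
    apply (hf s hs); rewrite qs, ps, t'0 in q''s; nra.
  - exists s0; split; [exact hs0 | split; [|exact hts0]].
    apply (ex_derive_continuous (torsion alpha) s0), ht, hs0.
Qed.

Theorem theorem2 (a b : Rbar) (f : R -> R) (alpha alpha_f : R -> E3) :
  let I := open_interval a b in
  has_primitive I f ->
  nonzero_on I f ->
  unit_speed_curve I alpha ->
  (forall s, I s -> 0 < curvature alpha s) ->
  is_f_position I f alpha alpha_f ->
  (f_rectifying I alpha alpha_f ->
     exists F : R -> R, antiderivative I f F /\
       norm_formula I F alpha_f /\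
       tangential_formula I F alpha alpha_f /\
       normal_length_constant I alpha alpha_f /\
       binormal_constant I alpha alpha_f) /\
  (forall F : R -> R, antiderivative I f F ->
     (nowhere_zero_on I f -> norm_formula I F alpha_f ->
        f_rectifying I alpha alpha_f) /\
     (tangential_formula I F alpha alpha_f ->
        f_rectifying I alpha alpha_f) /\
     (nowhere_zero_on I f -> normal_length_constant I alpha alpha_f ->
        ~ constant_on I (fun s => enorm (alpha_f s)) ->
        f_rectifying I alpha alpha_f) /\
     (nowhere_zero_on I f -> binormal_constant I alpha alpha_f ->
        f_rectifying I alpha alpha_f)).
Proof.
  intros I _ hfnz hu hk hpos.
  assert (hI : open I) by apply open_open_interval.
  assert (hreg : regular_curve I alpha) by now split.
  split; [now apply f_rectifying_properties|].
  intros F hF; split; [|split; [|split]].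
  - intros hf hn; apply (f_rectifying_of_tangential I f F); auto.
    now apply (tangential_of_norm I f).
  - now apply (f_rectifying_of_tangential I f F).
  - now apply f_rectifying_of_normal_length.
  - now apply f_rectifying_of_binormal.
Qed.
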